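(* Let $F$ be a finite field that is an extension of $\mathbb{F}_4$, let $d=4(\sqrt{|F|}-1)+1$, and for each $a \in F^*$ let $g_{F,a}(x)=x^7-a x^4-\tau_F(a) x^3 + 1$ and let $Z(a)$ be the number of distinct roots of $g_{F,a}(x)$ that lie in the unit circle $U_F$. Let $\mathcal{Z}=\{Z(a): a \in F^*\}$. Then: (i) If $[F:\mathbb{F}_4]$ is even, then $\mathcal{Z} \subseteq \{0,1,2,3,5\}$. (ii) If $[F:\mathbb{F}_4]$ is odd and greater than $1$, then $\mathcal{Z} \subseteq \{0,1,2,3,4,5\}$. (iii) If $F=\mathbb{F}_4$, then $d$ is degenerate over $F$ and $\mathcal{Z}=\{1,3\}$.
   Context: $F^*$ denotes the group of units of $F$. For a finite field $F$ that is an even degree extension of its prime subfield $\mathbb{F}_p$, the conjugation map is $\tau_F\colon\overline{F}\to\overline{F}$, $\tau_F(x)=x^{\sqrt{|F|}}$, where $\overline{F}$ is the algebraic closure. The unit circle of $F$ is $U_F=\{u \in \overline{F}: u\,\tau_F(u)=1\}$, which is the cyclic subgroup of $F^*$ of order $\sqrt{|F|}+1$. An exponent $d$ is degenerate over $F=\mathbb{F}_{p^n}$ if $d$ is congruent to a power of $p$ modulo $p^n-1$. *)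

(* Defs.v *)
From mathcomp Require Import all_boot all_order all_algebra all_field.

Set Implicit Arguments.
Unset Strict Implicit.
Unset Printing Implicit Defensive.

Import GRing.Theory.
Local Open Scope ring_scope.

Definition distinct_roots (K : closedFieldType) (p : {poly K}) : seq K :=
  undup (sval (closed_field_poly_normal p)).

Lemma mem_distinct_roots (K : closedFieldType) (p : {poly K}) (x : K) :
  p != 0 -> (x \in distinct_roots p) = root p x.
Proof.
move=> nz_p; rewrite mem_undup; case: closed_field_poly_normal => r /= Dp.
by rewrite [in RHS]Dp rootZ ?lead_coef_eq0 // root_prod_XsubC.
Qed.

(* [Nat.sqrt] rounds down; it is the square root of #|F| exactly when F has
   even degree over its prime field, the only case of interest here. *)
Definition sqrt_card (F : finFieldType) : nat := Nat.sqrt #|F|.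

Section UnitCircle.

(* [iota] is the embedding of F in its algebraic closure [K]. *)
Variables (F : finFieldType) (K : closedFieldType) (iota : {rmorphism F -> K}).

Definition tau (x : K) : K := x ^+ sqrt_card F.

Definition unit_circle : {pred K} := [pred u | u * tau u == 1].

Definition g (a : F) : {poly K} :=
  'X^7 - (iota a)%:P * 'X^4 - (tau (iota a))%:P * 'X^3 + 1.

Definition Z (a : F) : nat :=
  size [seq u <- distinct_roots (g a) | u \in unit_circle].

Definition Zset : seq nat := [seq Z a | a : F in GRing.unit].

End UnitCircle.

Definition degenerate (F : finFieldType) (d : nat) : Prop :=
  exists2 p : nat, p \in [pchar F] & exists k : nat, d = p ^ k %[mod #|F|.-1].

(* Main.v *)
Require Import Defs.
From mathcomp Require Import all_boot all_order all_algebra all_field.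
From mathcomp Require Import ring.
From Stdlib Require PeanoNat.

Set Implicit Arguments.
Unset Strict Implicit.
Unset Printing Implicit Defensive.

Import GRing.Theory.
Local Open Scope ring_scope.

(* Write q = sqrt |F| and b = a^q, so that g = X^7 + a X^4 + b X^3 + 1. If
   ab = 1, then g = (X^4 + b)(X^3 + a) and the roots are counted directly.
   Otherwise g has seven distinct roots r_i. The element
   A = \sum_(i < j) r_i / (r_i + r_j) satisfies A^2 + A = \sum_(i <> j)
   r_i^2 r_j / (r_i + r_j)^3, and summing over j first (Newton's identities for
   g(X + r_i)) and then over i (Euler's identities for \sum_i r_i^k / g'(r_i))
   shows that this vanishes. Hence A lies in F_2 and A^q = A. On the other hand
   psi : x |-> x^-q permutes the roots, its fixed points being the roots on the
   unit circle, and A^q = A + 21 + inv(psi), with inv the number of inversions;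
   so psi is an odd permutation. This excludes 7 fixed points, and also 4 (psi
   would be a 3-cycle); 6 fixed points are impossible for any permutation. *)

(** * Symmetric functions of the roots: Newton's and Euler's identities *)

(** The coefficients of [e] are the elementary symmetric functions of [ws]; adjoining w replaces e_k
    by e_k + w e_(k-1), which gives the induction. *)
Lemma newton_sums (R : comNzRingType) (ws : seq R) :
  let e := \prod_(w <- ws) (1 + w%:P * 'X) in
  [/\ e`_0 = 1, \sum_(w <- ws) w = e`_1,
      \sum_(w <- ws) w ^+ 2 = e`_1 ^+ 2 - 2 * e`_2
    & \sum_(w <- ws) w ^+ 3 = e`_1 ^+ 3 - 3 * e`_1 * e`_2 + 3 * e`_3].
Proof.
elim: ws => [|w ws /= [e0 p1 p2 p3]].
  by move=> e; rewrite /e !big_nil !coef1 /=; split=> //; ring.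
rewrite !big_cons p1 p2 p3; set e := \prod_(_ <- _) _ in e0 p1 p2 p3 *.
have -> : (1 + w%:P * 'X) * e = e + w *: (e * 'X) by rewrite -mul_polyC; ring.
by rewrite !(coefD, coefZ, coefMX) /= e0; split; ring.
Qed.

(** Since f(X + x) = f'(x) X \prod_(y != x) (1 + X / (x - y)), the quotients c_(k+1) / c_1 are the
    elementary symmetric functions of the 1 / (x - y), and Newton's identities apply. *)
Lemma inv_diff_sums (F : fieldType) (rs : seq F) (x : F) :
    uniq rs -> x \in rs ->
  let f := \prod_(y <- rs) ('X - y%:P) in
  let c := f \Po ('X + x%:P) in
  [/\ c`_1 = \prod_(y <- rs | y != x) (x - y),
      \sum_(y <- rs | y != x) (x - y)^-1 ^+ 2
        = (c`_2 / c`_1) ^+ 2 - 2 * (c`_3 / c`_1)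
    & \sum_(y <- rs | y != x) (x - y)^-1 ^+ 3
        = (c`_2 / c`_1) ^+ 3 - 3 * (c`_2 / c`_1) * (c`_3 / c`_1)
          + 3 * (c`_4 / c`_1)].
Proof.
move=> Urs rs_x /=.
set c := _ \Po _; set C := \prod_(y <- rs | _) _.
have C_neq0 : C != 0.
  by rewrite prodf_seq_neq0; apply/allP=> y _; rewrite subr_eq0 eq_sym implybb.
pose ws := [seq (x - y)^-1 | y <- rs & y != x].
have Dc : c = C *: ('X * \prod_(w <- ws) (1 + w%:P * 'X)).
  rewrite /c (bigD1_seq x) //= comp_polyM rmorph_prod /= comp_polyB comp_polyX.
  rewrite comp_polyC addrK scalerAr; congr (_ * _).
  rewrite big_map big_filter -mul_polyC /C rmorph_prod -big_split /=.
  apply: eq_bigr => y neq_yx; rewrite comp_polyB comp_polyX comp_polyC.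
  rewrite mulrDr mulr1 mulrA -polyCM divff ?subr_eq0 1?eq_sym // mul1r.
  by rewrite polyCB; ring.
have [] := newton_sums ws; set e := \prod_(w <- _) _ in Dc *.
have cS k : c`_k.+1 = C * e`_k by rewrite Dc coefZ coefXM.
rewrite !big_map !big_filter !cS => e0 _ -> ->; rewrite e0.
by split; [rewrite mulr1 | field | field].
Qed.

(* Lagrange interpolation of X^k, read off in the top degree. *)
Lemma lagrange_top_coef (F : fieldType) (rs : seq F) (k : nat) :
    uniq rs -> (k < size rs)%N ->
  \sum_(x <- rs) x ^+ k / \prod_(y <- rs | y != x) (x - y)
    = (k == (size rs).-1)%:R.
Proof.
move=> Urs ltk.
pose N x := \prod_(y <- rs | y != x) ('X - y%:P).
pose C x := \prod_(y <- rs | y != x) (x - y).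
have szN x : x \in rs -> size (N x) = size rs.
  move=> rs_x; rewrite /N -big_filter size_prod_XsubC -rem_filter //.
  by rewrite size_rem // prednK //; case: (rs) rs_x.
have C_neq0 x : C x != 0.
  by rewrite prodf_seq_neq0; apply/allP=> y _; rewrite subr_eq0 eq_sym implybb.
have : 'X^k - \sum_(x <- rs) (x ^+ k / C x) *: N x = 0.
  apply: (roots_geq_poly_eq0 _ Urs).
    apply/allP=> z rs_z; rewrite rootE !hornerE horner_sum (bigD1_seq z) //=.
    rewrite big1 ?addr0 => [|x neq_xz]; last first.
      apply/eqP; rewrite hornerZ horner_prod mulf_eq0 prodf_seq_eq0.
      apply/orP; right; apply/hasP; exists z => //.
      by rewrite eq_sym neq_xz hornerXsubC subrr eqxx.
    rewrite hornerZ /N horner_prod (eq_bigr (fun y => z - y)).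
      by rewrite -/(C z) divfK // subrr.
    by move=> y _; rewrite hornerXsubC.
  rewrite (leq_trans (size_polyD _ _)) // geq_max size_polyXn ltk size_polyN.
  rewrite (leq_trans (size_sum _ _ _)) // big_seq.
  by apply/bigmax_leqP_seq=> x rs_x _; rewrite (leq_trans (size_scale_leq _ _)) ?szN.
move/(congr1 (coefp (size rs).-1)); rewrite /= coefB coefXn coef0 coef_sum.
move/eqP; rewrite subr_eq0 eq_sym => /eqP; rewrite eq_sym => <-.
rewrite big_seq [RHS]big_seq; apply: eq_bigr => x rs_x; rewrite coefZ.
have /monicP : N x \is monic by rewrite /N monic_prod_XsubC.
by rewrite lead_coefE szN // => ->; rewrite mulr1.
Qed.

(** * Sums over pairs of entries of a sequence *)

Section PairSum.

Variables (V : nmodType) (T : eqType).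
Implicit Types (F G : T -> T -> V) (s t : seq T).

(* The sum over the pairs i < j of positions in s. *)
Fixpoint pair_sum F s : V :=
  if s is x :: s' then \sum_(y <- s') F x y + pair_sum F s' else 0.

Lemma eq_pair_sum F G s :
  {in s &, forall x y, F x y = G x y} -> pair_sum F s = pair_sum G s.
Proof.
elim: s => //= x s IHs eqFG; rewrite IHs => [|y z sy sz]; last first.
  by apply: eqFG; rewrite inE ?sy ?sz orbT.
congr (_ + _); apply: eq_big_seq => y sy.
by apply: eqFG; rewrite inE ?eqxx ?sy ?orbT.
Qed.

Lemma pair_sumD F G s :
  pair_sum (fun x y => F x y + G x y) s = pair_sum F s + pair_sum G s.
Proof.
by elim: s => /= [|x s ->]; rewrite ?addr0 // big_split addrACA.
Qed.

Lemma pair_sum_cat F s t :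
  pair_sum F (s ++ t)
    = pair_sum F s + \sum_(x <- s) \sum_(y <- t) F x y + pair_sum F t.
Proof.
elim: s => /= [|x s ->]; first by rewrite big_nil !add0r.
rewrite big_cat big_cons /= !addrA; do 2!congr (_ + _).
exact: addrAC.
Qed.

(** This passes from unordered pairs to ordered ones, where the inner sum can be evaluated for a
    fixed x. *)
Lemma sum_neq_pair_sum F s : uniq s ->
  \sum_(x <- s) \sum_(y <- s | y != x) F x y
    = pair_sum (fun x y => F x y + F y x) s.
Proof.
elim: s => /= [|x s IHs] => [|/andP[xs Us]]; first by rewrite big_nil.
have neq_x y : y \in s -> y != x by move=> sy; apply: contraNneq xs => <-.
rewrite -IHs // !big_cons eqxx /= !big_split /= -addrA; congr (_ + _).
  rewrite big_seq_cond [RHS]big_seq; apply: eq_bigl => y.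
  by case sy: (y \in s); rewrite //= neq_x.
rewrite -big_split /=; apply: eq_big_seq => y sy.
by rewrite big_cons eq_sym neq_x.
Qed.

End PairSum.

(** * The polynomial and the Frobenius map in characteristic two *)

Section CharTwo.

Variable K : fieldType.
Hypothesis charK : 2%N \in [pchar K].

(** An identity special to characteristic two becomes one valid in every field once half the
    difference of its sides is supplied as [z]. *)
Let eq_mod2 (z x y : K) : x = y + 2 * z -> x = y.
Proof. by rewrite (pcharf0 charK) mul0r addr0. Qed.

(** The conjugate of a is a free parameter b here. The signs are those of [g], so that [g] is an
    instance by conversion. *)
Definition niho_poly (a b : K) : {poly K} :=
  'X^7 - a%:P * 'X^4 - b%:P * 'X^3 + 1.

Lemma niho_polyE a b x :
  (niho_poly a b).[x] = x ^+ 7 + a * x ^+ 4 + b * x ^+ 3 + 1.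
Proof. by rewrite /niho_poly !hornerE !(oppr_pchar2 charK). Qed.

(** With u = x^4 + b, the first three coefficients are x^2 u, x u and u. Hence c_2 / c_1 and c_3 /
    c_1 are just 1 / x and 1 / x^2. *)
Lemma niho_poly_taylor a b x :
  let c := niho_poly a b \Po ('X + x%:P) in
  [/\ c`_1 = x ^+ 6 + b * x ^+ 2, c`_2 = x ^+ 5 + b * x, c`_3 = x ^+ 4 + b
    & c`_4 = x ^+ 3 + a].
Proof.
move=> c.
have Dc : c = 'X^7 + (7 * x)%:P * 'X^6 + (21 * x ^+ 2)%:P * 'X^5
  + (35 * x ^+ 3 - a)%:P * 'X^4 + (35 * x ^+ 4 - 4 * a * x - b)%:P * 'X^3
  + (21 * x ^+ 5 - 6 * a * x ^+ 2 - 3 * b * x)%:P * 'X^2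
  + (7 * x ^+ 6 - 4 * a * x ^+ 3 - 3 * b * x ^+ 2)%:P * 'X
  + (x ^+ 7 - a * x ^+ 4 - b * x ^+ 3 + 1)%:P.
  rewrite /c /niho_poly rmorphD !rmorphB rmorph1 !(rmorphXn, rmorphM) /=.
  by rewrite !(comp_polyX, comp_polyC); ring.
rewrite Dc !coefE /=; split.
- by apply: (eq_mod2 (z := 3 * x ^+ 6 - 2 * a * x ^+ 3 - 2 * b * x ^+ 2)); ring.
- by apply: (eq_mod2 (z := 10 * x ^+ 5 - 3 * a * x ^+ 2 - 2 * b * x)); ring.
- by apply: (eq_mod2 (z := 17 * x ^+ 4 - 2 * a * x - b)); ring.
- by apply: (eq_mod2 (z := 17 * x ^+ 3 - a)); ring.
Qed.

Lemma frobD m (x y : K) :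
  (x + y) ^+ (2 ^ m) = x ^+ (2 ^ m) + y ^+ (2 ^ m).
Proof.
apply: exprDn_pchar; rewrite pnatX; apply/orP; left.
by rewrite pnatE // charK.
Qed.

Lemma frob_inj m : injective (fun x : K => x ^+ (2 ^ m)).
Proof.
move=> x y /= /eqP; rewrite -subr_eq0 (oppr_pchar2 charK) -frobD.
rewrite expf_eq0 expn_gt0 /= -[X in _ + X](oppr_pchar2 charK) subr_eq0.
by move/eqP.
Qed.

Lemma frob_pair_sum m (F : K -> K -> K) (s : seq K) :
  pair_sum F s ^+ (2 ^ m) = pair_sum (fun x y => F x y ^+ (2 ^ m)) s.
Proof.
have frob0 : (0 : K) ^+ (2 ^ m) = 0 by rewrite expr0n expn_eq0.
elim: s => //= x s IHs; rewrite frobD IHs; congr (_ + _).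
exact: (big_morph _ (frobD m) frob0).
Qed.

(** * Berlekamp's substitute for the discriminant *)

(** This plays the role of the factor x - y of a Vandermonde product: exchanging x and y adds 1
    instead of changing a sign, so the sum over pairs detects the parity of a permutation of the
    roots. *)
Definition ratio (x y : K) : K := x / (x + y).

Lemma ratio_swap x y : x != y -> ratio y x = ratio x y + 1.
Proof.
move=> neq_xy; have xy0 : x + y != 0.
  by rewrite -(oppr_pchar2 charK y) subr_eq0.
apply: (eq_mod2 (z := - ratio x y)).
by rewrite /ratio [y + x]addrC; field.
Qed.

Lemma pair_sum_ratio_swap (s : seq K) : uniq s ->
  pair_sum (fun x y => ratio y x) s = pair_sum ratio s + 'C(size s, 2)%:R.
Proof.
elim: s => [|x s IHs] /= => [_|/andP[xs Us]]; first by rewrite addr0.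
have -> : \sum_(y <- s) ratio y x = \sum_(y <- s) ratio x y + (size s)%:R.
  rewrite -sum1_size natr_sum -big_split /=; apply: eq_big_seq => y sy.
  by rewrite ratio_swap //; apply: contraNneq xs => ->.
rewrite IHs // binS bin1 natrD; ring.
Qed.

Lemma size_niho_poly a b : size (niho_poly a b) = 8%N.
Proof.
rewrite /niho_poly -addrA -addrA size_polyDl ?size_polyXn // ltnS.
rewrite (leq_trans (size_polyD _ _)) // geq_max size_polyN mul_polyC.
rewrite (leq_trans (size_scale_leq _ _)) ?size_polyXn //=.
rewrite (leq_trans (size_polyD _ _)) // geq_max size_polyN mul_polyC.
by rewrite (leq_trans (size_scale_leq _ _)) ?size_polyXn //= size_poly1.
Qed.

Lemma niho_neq0 a b : niho_poly a b != 0.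
Proof. by rewrite -size_poly_gt0 size_niho_poly. Qed.

Lemma niho_monic a b : niho_poly a b \is monic.
Proof.
by rewrite monicE lead_coefE size_niho_poly /niho_poly !coefE /= !(mulr0, subr0, addr0).
Qed.

Lemma size_niho_roots a b (rs : seq K) :
  \prod_(y <- rs) ('X - y%:P) = niho_poly a b -> size rs = 7%N.
Proof. by move=> Df; have := size_prod_XsubC rs id; rewrite Df size_niho_poly => -[]. Qed.

(* The sum of the ratios is a root of Berlekamp's quadratic resolvent, whose
   constant term vanishes for this polynomial. *)
Lemma pair_sum_ratio_idem (rs : seq K) (a b : K) :
    uniq rs -> \prod_(y <- rs) ('X - y%:P) = niho_poly a b ->
  pair_sum ratio rs ^+ 2 = pair_sum ratio rs.
Proof.
move=> Urs Df.
have szrs := size_niho_roots Df.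
(* v symmetrizes to x y / (x + y)^2, the constant term of the equation of the
   ratio x / (x + y); unlike it, v can be summed over ordered pairs. *)
pose v (x y : K) := x ^+ 2 * y / (x + y) ^+ 3.
have vE x y : ratio x y ^+ 2 + ratio x y = v x y + v y x.
  rewrite /ratio /v [y + x]addrC.
  have [->|xy0] := eqVneq (x + y) 0.
    by rewrite !expr0n /= !(invr0, mulr0, expr0n, addr0).
  by apply: (eq_mod2 (z := x ^+ 2 / (x + y) ^+ 2)); field.
apply/eqP; rewrite -subr_eq0 (oppr_pchar2 charK) (frob_pair_sum 1) -pair_sumD.
rewrite (eq_pair_sum (G := fun x y => v x y + v y x)); last by move=> *; apply: vE.
rewrite -sum_neq_pair_sum //.
pose C (x : K) := \prod_(y <- rs | y != x) (x - y).
have inner x : x \in rs ->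
  \sum_(y <- rs | y != x) v x y = x ^+ 6 / C x + a * (x ^+ 3 / C x) + 1.
  move=> rs_x.
  have C_neq0 : C x != 0.
    by rewrite prodf_seq_neq0; apply/allP=> y _; rewrite subr_eq0 eq_sym implybb.
  have [] := inv_diff_sums Urs rs_x; rewrite Df -/(C x).
  have [-> -> -> ->] := niho_poly_taylor a b x => Dc1 s2 s3.
  rewrite -Dc1 in C_neq0 *.
  have /andP[x0 xb0] : (x != 0) && (x ^+ 4 + b != 0).
    rewrite -negb_or; apply: contraNN C_neq0 => /orP[/eqP->|/eqP xb0].
      by rewrite !expr0n /= mulr0 addr0.
    rewrite (_ : _ + _ = x ^+ 2 * (x ^+ 4 + b)); last by ring.
    by rewrite xb0 mulr0.
  (* Writing y = (x + y) + x gives v x y = x^2 / (x + y)^2 + x^3 / (x + y)^3, which brings in the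
     power sums of the 1 / (x - y). *)
  transitivity (x ^+ 3 * (\sum_(y <- rs | y != x) (x - y)^-1 ^+ 3)
                + x ^+ 2 * (\sum_(y <- rs | y != x) (x - y)^-1 ^+ 2)).
    rewrite !mulr_sumr -big_split /=; apply: eq_bigr => y neq_yx.
    rewrite /v (oppr_pchar2 charK).
    have xy0 : x + y != 0 by rewrite -(oppr_pchar2 charK y) subr_eq0 eq_sym.
    apply: (eq_mod2 (z := - x ^+ 3 / (x + y) ^+ 3)).
    by field.
  rewrite s2 s3.
  apply: (eq_mod2 (z := x * (x ^+ 3 + a) / (x ^+ 4 + b) - 2)).
  by field; rewrite xb0.
rewrite big_seq (eq_bigr _ inner) -big_seq !big_split /= -mulr_sumr.
(* Of the exponents 6 and 3 only 6 is the top degree, contributing 1; the constant 1 is summed over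
   seven roots. The total is 8 = 0. *)
rewrite !lagrange_top_coef ?szrs //= mulr0 addr0.
have -> : \sum_(x <- rs) (1 : K) = 7 by rewrite -[in RHS]szrs -sum1_size natr_sum.
apply/eqP; apply: (eq_mod2 (z := 4)); ring.
Qed.

(** * The map psi on the roots, with q = 2^m, and the parity argument *)

Definition conj_inv m (x : K) : K := (x ^+ (2 ^ m))^-1.

Definition circle m : {pred K} := [pred u | u * u ^+ (2 ^ m) == 1].

Lemma circle_conj_inv m x : x \in circle m -> conj_inv m x = x.
Proof.
rewrite inE => /eqP xq1; have xq0 : x ^+ (2 ^ m) != 0.
  by apply: contra_eq_neq xq1 => ->; rewrite mulr0 eq_sym oner_eq0.
by apply: (mulIf xq0); rewrite mulVf.
Qed.

(** As 0^-1 = 0, the element 0 is a fixed point off the circle and has to be set apart. *)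
Lemma conj_inv_circle m x : x != 0 -> conj_inv m x = x -> x \in circle m.
Proof. by move=> x0 fix_x; rewrite inE -{1}fix_x mulVf // expf_neq0. Qed.

Lemma conj_inv_inj m : injective (conj_inv m).
Proof. by move=> x y /invr_inj /frob_inj. Qed.

(** The q-th power acts on both arguments, and inverting both of them amounts to exchanging them. *)
Lemma ratio_frob m x y : x != 0 -> y != 0 ->
  ratio x y ^+ (2 ^ m) = ratio (conj_inv m y) (conj_inv m x).
Proof.
move=> x0 y0; rewrite /ratio /conj_inv exprMn exprVn frobD.
have : x ^+ (2 ^ m) != 0 by rewrite expf_neq0.
have : y ^+ (2 ^ m) != 0 by rewrite expf_neq0.
move: (x ^+ _) (y ^+ _) => X Y Y0 X0.
have -> : Y^-1 + X^-1 = (X + Y) / (X * Y) by field; rewrite X0 Y0.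
by rewrite invf_div mulrA [X * Y]mulrC mulKf.
Qed.

(** The q-th power turns a pair (x, y) into (psi y, psi x). Pairs inside [s] are thus swapped, and
    so are those between [s] and [t] after reindexing [t] along psi; each swap adds 1. The pairs
    inside [t] are left as they are: the extra [pair_sum ratio t] cancels the one contained in the
    sum over [s ++ t]. *)
Lemma pair_sum_ratio_frob m (s t : seq K) :
    uniq (s ++ t) -> 0 \notin s ++ t -> {in s, conj_inv m =1 id} ->
    perm_eq (map (conj_inv m) t) t ->
  pair_sum ratio (s ++ t) ^+ (2 ^ m)
    = pair_sum ratio (s ++ t) + ('C(size s, 2) + size s * size t)%:R
      + (pair_sum ratio t
         + pair_sum (fun x y => ratio (conj_inv m y) (conj_inv m x)) t).
Proof.
move=> Ust st0 fix_s perm_t; rewrite frob_pair_sum.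
rewrite [LHS](eq_pair_sum
  (G := fun x y => ratio (conj_inv m y) (conj_inv m x))); last first.
  by move=> x y sx sy; rewrite /= ratio_frob //; apply: contraNneq st0 => <-.
move: Ust; rewrite cat_uniq => /and3P[Us st _].
rewrite !pair_sum_cat.
rewrite (eq_pair_sum (s := s) (G := fun x y => ratio y x)) => [|x y sx sy]; last first.
  by rewrite !fix_s.
rewrite pair_sum_ratio_swap //.
have -> : \sum_(x <- s) \sum_(y <- t) ratio (conj_inv m y) (conj_inv m x)
    = \sum_(x <- s) \sum_(y <- t) ratio x y + (size s * size t)%:R.
  rewrite natrM -[in (size s)%:R]sum1_size natr_sum mulr_suml -big_split /=.
  apply: eq_big_seq => x sx; rewrite fix_s // mul1r.
  rewrite -(big_map (conj_inv m) predT (fun y => ratio y x)) (perm_big _ perm_t) /=.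
  rewrite -sum1_size natr_sum -big_split /=; apply: eq_big_seq => y ty.
  rewrite ratio_swap //; apply: contraNneq st => eq_xy.
  by apply/hasP; exists y; rewrite // -eq_xy.
apply: (eq_mod2 (z := - pair_sum ratio t)).
by rewrite natrD; ring.
Qed.

(** The pairs (x, y), (x, z), (y, z) become (z, y), (x, y), (x, z), so exactly one of them is
    swapped. *)
Lemma pair_sum_ratio_cycle m x y z : uniq [:: x; y; z] ->
    [/\ conj_inv m x = y, conj_inv m y = z & conj_inv m z = x] ->
  let t := [:: x; y; z] in
  pair_sum ratio t + pair_sum (fun x y => ratio (conj_inv m y) (conj_inv m x)) t
    = 1.
Proof.
rewrite /= !inE negb_or -!andbA => /and4P[_ _ neq_yz _] [Dy Dz Dx].
rewrite !big_cons !big_nil Dy Dz Dx !addr0 (ratio_swap neq_yz).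
by apply: (eq_mod2 (z := ratio x y + ratio x z + ratio y z)); ring.
Qed.

Lemma frob_idem m (x : K) : x ^+ 2 = x -> x ^+ (2 ^ m) = x.
Proof. by move=> xx; elim: m => [|m IHm]; rewrite ?expr1 // expnS exprM xx. Qed.

(** The q-th power of g(x) = 0 exchanges a and b; dividing by x^(7q) reverses the coefficients,
    which exchanges them back. *)
Lemma conj_inv_root m a b x : a ^+ (2 ^ m) = b -> b ^+ (2 ^ m) = a ->
  root (niho_poly a b) x -> x != 0 -> root (niho_poly a b) (conj_inv m x).
Proof.
move=> aq bq; rewrite !rootE !niho_polyE => /eqP gx x0.
have X0 : x ^+ (2 ^ m) != 0 by rewrite expf_neq0.
have := congr1 (fun y => y ^+ (2 ^ m)) gx; rewrite /= expr0n expn_eq0 /=.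
rewrite !frobD [(a * _) ^+ _]exprMn [(b * _) ^+ _]exprMn aq bq expr1n.
rewrite !(exprAC _ _ (2 ^ m)) /conj_inv.
move: (x ^+ _) X0 => X X0 gX.
rewrite (_ : _ + _ = (X ^+ 7 + b * X ^+ 4 + a * X ^+ 3 + 1) / X ^+ 7).
  by rewrite gX mul0r.
by field.
Qed.

Lemma three_cycle (T : eqType) (psi : T -> T) (t : seq T) :
    injective psi -> uniq t -> size t = 3%N -> {in t, forall x, psi x \in t} ->
    {in t, forall x, psi x != x} ->
  exists x y z, perm_eq t [:: x; y; z] /\ [/\ psi x = y, psi y = z & psi z = x].
Proof.
move=> inj_psi Ut szt stab_t nofix_t.
case: t szt Ut stab_t nofix_t => [|x t'] //= [szt] Ut stab nofix.
have tx : x \in x :: t' by rewrite inE eqxx.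
pose y := psi x; pose z := psi y.
have ty : y \in x :: t' by apply: stab.
have tz : z \in x :: t' by apply: stab.
have neq_yx : y != x by apply: nofix.
have neq_zy : z != y by apply: nofix.
have perm3 w : w \in x :: t' -> w != x -> w != y -> perm_eq (x :: t') [:: x; y; w].
  move=> tw wx wy; have Uw : uniq [:: x; y; w].
    by rewrite /= !inE negb_or ![x == _]eq_sym neq_yx wx eq_sym wy.
  rewrite perm_sym; apply: uniq_perm => //.
  have sub : {subset [:: x; y; w] <= x :: t'}.
    by move=> u; rewrite !inE => /or3P[]/eqP-> //; rewrite -in_cons.
  by case: (uniq_min_size Uw sub); rewrite //= szt.
have [zx | neq_zx] := eqVneq z x; last first.
  exists x, y, z; split; first exact: perm3.
  split=> //; have /perm_mem zt := perm3 z tz neq_zx neq_zy.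
  have := stab z tz; rewrite zt !inE => /or3P[/eqP // | /eqP | /eqP].
    by move/inj_psi=> zx; rewrite zx eqxx in neq_zx.
  by move/inj_psi=> zy; rewrite zy eqxx in neq_zy.
(* Otherwise psi swaps x and y, and the third element w has no possible image: x and y are taken,
   and w may not be fixed. *)
have [w tw /andP[wx wy]] : exists2 w, w \in x :: t' & (w != x) && (w != y).
  case: (t') szt Ut => [|u [|v []]] // _; rewrite /= !inE negb_or -!andbA.
  case/and4P=> xu xv uv _; have [uy|uy] := eqVneq u y.
    by exists v; rewrite ?inE ?eqxx ?orbT // eq_sym xv -uy eq_sym uv.
  by exists u; rewrite ?inE ?eqxx ?orbT // eq_sym xu uy.
have := nofix w tw; have := stab w tw; rewrite (perm_mem (perm3 w tw wx wy)) !inE.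
case/or3P=> /eqP eq_w; rewrite ?eq_w ?eqxx // => _.
  by move: wy; rewrite (inj_psi w y) ?eqxx // eq_w -[psi y]/z zx.
by move: wx; rewrite (inj_psi w x) ?eqxx.
Qed.

Lemma count_circle_nondegenerate m a b (rs : seq K) :
    a ^+ (2 ^ m) = b -> b ^+ (2 ^ m) = a ->
    uniq rs -> \prod_(y <- rs) ('X - y%:P) = niho_poly a b ->
  count (circle m) rs \in [:: 0; 1; 2; 3; 5]%N.
Proof.
move=> aq bq Urs Df; have szrs := size_niho_roots Df.
have rsE x : (x \in rs) = root (niho_poly a b) x by rewrite -Df root_prod_XsubC.
have rs0 : 0 \notin rs.
  by rewrite rsE rootE niho_polyE !expr0n /= !mulr0 !add0r oner_eq0.
have rs_neq0 x : x \in rs -> x != 0 by apply: contraTneq => ->.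
pose s := filter (circle m) rs; pose t := filter (predC (circle m)) rs.
have perm_rs : perm_eq rs (s ++ t) by rewrite perm_sym perm_filterC.
have Ust : uniq (s ++ t) by rewrite -(perm_uniq perm_rs).
have st0 : 0 \notin s ++ t by rewrite -(perm_mem perm_rs).
have szst : (size s + size t = 7)%N by rewrite -size_cat -(perm_size perm_rs).
have fix_s : {in s, conj_inv m =1 id}.
  by move=> x; rewrite mem_filter => /andP[/circle_conj_inv].
have nofix_t : {in t, forall x, conj_inv m x != x}.
  move=> x; rewrite mem_filter => /andP[Ux /rs_neq0 x0].
  by apply: contra Ux => /eqP; apply: conj_inv_circle.
have stab_t : {in t, forall x, conj_inv m x \in t}.
  move=> x tx; have := nofix_t x tx; move: tx; rewrite mem_filter => /andP[Ux rs_x] nfx.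
  rewrite mem_filter rsE conj_inv_root ?rs_neq0 -?rsE // andbT.
  by apply: contra nfx => /circle_conj_inv /conj_inv_inj ->.
have Ut : uniq t by rewrite filter_uniq.
have perm_t : perm_eq (map (conj_inv m) t) t.
  have Upt : uniq (map (conj_inv m) t) by rewrite map_inj_uniq //; apply: conj_inv_inj.
  apply: uniq_perm => //.
  have sub : {subset map (conj_inv m) t <= t} by move=> _ /mapP[x tx ->]; apply: stab_t.
  by case: (uniq_min_size Upt sub); rewrite ?size_map.
(* The sum of the ratios lies in F_2 for every ordering of the roots, so [t] may be rearranged, in
   particular along a cycle of psi. *)
have key (t' : seq K) : perm_eq t t' ->
    ('C(size s, 2) + size s * size t)%:R
    + (pair_sum ratio t'
       + pair_sum (fun x y => ratio (conj_inv m y) (conj_inv m x)) t') = 0.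
  move=> tt'; have perm_st : perm_eq (s ++ t) (s ++ t') by rewrite perm_cat2l.
  have := @pair_sum_ratio_frob m s t'.
  rewrite -(perm_uniq perm_st) -(perm_mem perm_st) -(perm_size tt').
  rewrite frob_idem => [eq_st|].
    apply: (addrI (pair_sum ratio (s ++ t'))); rewrite addr0 addrA -eq_st //.
    by rewrite -(permPl (perm_map (conj_inv m) tt')) -(permPr tt').
  apply: (@pair_sum_ratio_idem _ a b); first by rewrite -(perm_uniq perm_st).
  by rewrite -Df; apply: perm_big; rewrite perm_sym (perm_trans perm_rs).
have odd_neq0 n : odd n -> n%:R != 0 :> K.
  by move=> odd_n; rewrite -(dvdn_pcharf charK) dvdn2 odd_n.
rewrite -size_filter -/s.
(* With seven fixed points the identity [key] would read 'C(7, 2) = 21 = 0. *)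
have szt0 : size t != 0%N.
  apply/eqP => szt; move/size0nil: (szt) => t0; move: (key t).
  rewrite szt addn0 in szst; rewrite szt szst t0 /= !addr0 => key0.
  by have := odd_neq0 21 isT; rewrite key0 ?eqxx.
have szt1 : size t != 1%N.
  apply/eqP=> szt; have [x tE] : exists x, t = [:: x].
    by case: (t) szt => [|x []] //; exists x.
  have tx : x \in t by rewrite tE mem_head.
  by have := stab_t x tx; rewrite {1}tE inE (negPf (nofix_t x tx)).
(* With four fixed points and a 3-cycle it would read 6 + 12 + 1 = 19 = 0. *)
have szt3 : size t != 3%N.
  apply/eqP=> szt; have szs : size s = 4%N by move: szst; rewrite szt addn3 => -[].
  have [x [y [z [tE psiE]]]] := three_cycle (@conj_inv_inj m) Ut szt stab_t nofix_t.
  have := key _ tE; rewrite szs szt pair_sum_ratio_cycle // -?(perm_uniq tE) //.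
  by rewrite -mulrSr => /eqP; apply/negP; apply: odd_neq0.
have : (size t <= 7)%N by rewrite -szst leq_addl.
have -> : size s = (7 - size t)%N by rewrite -szst addnK.
by case: (size t) szt0 szt1 szt3 => [|[|[|[|[|[|[|[|n]]]]]]]].
Qed.

(** * The case a b = 1, and separability outside it *)

Lemma root_niho_degenerate a b x : a * b = 1 -> root (niho_poly a b) x ->
  (x ^+ 4 == b) || (x ^+ 3 == a).
Proof.
move=> ab1; rewrite rootE niho_polyE -ab1 => /eqP gx.
have /eqP : (x ^+ 4 - b) * (x ^+ 3 - a) = 0.
  by rewrite -gx !(oppr_pchar2 charK); ring.
by rewrite mulf_eq0 !subr_eq0.
Qed.

(** The equation x^4 = b has at most one root, fourth powers being injective, and x^3 = a at most
    three. For even m the order q + 1 of the circle is prime to 3, which leaves at most one cube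
    root of a on it. *)
Lemma count_circle_degenerate m a b (rs : seq K) : uniq rs -> a * b = 1 ->
    {in rs, forall x, root (niho_poly a b) x} ->
  (count (circle m) rs <= if odd m then 4 else 2)%N.
Proof.
move=> Urs ab1 rsP; rewrite -size_filter; set s := filter _ _.
have Us : uniq s by rewrite filter_uniq.
rewrite -(count_predC (fun x => x ^+ 4 == b)) -!size_filter.
have sz4 : (size [seq x <- s | x ^+ 4 == b] <= 1)%N.
  have : uniq [seq x <- s | x ^+ 4 == b] by rewrite filter_uniq.
  have eqP4 x : x \in [seq x <- s | x ^+ 4 == b] -> x ^+ 4 = b.
    by rewrite mem_filter => /andP[/eqP].
  case: [seq x <- s | _] eqP4 => [|x [|y l]] //= P4; rewrite !inE negb_or -!andbA.
  case/andP=> /eqP[]; apply: (@frob_inj 2).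
  by rewrite /= !P4 // !inE eqxx ?orbT.
set s3 := filter (predC _) _.
have Us3 : uniq s3 by rewrite filter_uniq.
have s3P x : x \in s3 -> (x \in circle m) && (x ^+ 3 == a).
  rewrite !mem_filter => /and3P[x4 Ux /rsP /(root_niho_degenerate ab1)].
  by rewrite (negPf (x4 : x ^+ 4 != b)) /= => ->; rewrite andbT.
case: ifP => [_|even_m].
  apply: (leq_add sz4); rewrite -ltnS.
  have <- : size ('X^3 - a%:P) = 4%N by rewrite size_XnsubC.
  apply: max_poly_roots => //; first by rewrite -size_poly_eq0 size_XnsubC.
  by apply/allP=> x /s3P/andP[_ /eqP x3]; rewrite rootE !hornerE x3 subrr.
apply: (leq_add sz4).
case: s3 Us3 s3P => [|x [|y l]] //=; rewrite !inE negb_or -!andbA.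
case/andP=> neq_xy _ s3P.
have /andP[Ux /eqP x3] := s3P x (mem_head _ _).
have /andP[Uy /eqP y3] : (y \in circle m) && (y ^+ 3 == a) by rewrite s3P // !inE eqxx orbT.
have a0 : a != 0 by apply: contra_eq_neq ab1 => ->; rewrite mul0r eq_sym oner_eq0.
(* For even m, 2^m is a power of 4, hence 1 modulo 3. On the circle z^(q + 1) = 1 then reads a^k z^2
   = 1, which determines z^2 and therefore z. *)
have [k Dk] : exists k, (2 ^ m).+1 = (3 * k + 2)%N.
  exists ((2 ^ m) %/ 3)%N; rewrite mulnC {1}(divn_eq (2 ^ m) 3).
  suff -> : (2 ^ m %% 3 = 1)%N by rewrite addn2 addn1.
  rewrite -(odd_double_half m) even_m add0n -muln2 mulnC expnM.
  by rewrite -modnXm exp1n.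
have sq z : z \in circle m -> z ^+ 3 = a -> a ^+ k * z ^+ 2 = 1.
  by rewrite inE => /eqP Uz <-; rewrite -exprM -exprD -Dk exprS.
case/eqP: neq_xy; apply: (@frob_inj 1); apply: (@mulfI _ (a ^+ k)).
  by rewrite expf_neq0.
by rewrite !sq.
Qed.

(** Here g' = X^2 (X^4 + b) and g = (X^4 + b)(X^3 + a) + (1 + a b). A common root is not 0, so it
    satisfies x^4 = b, which forces a b = 1. *)
Lemma niho_deriv_neq0 a b : a * b != 1 ->
  forall x, root (niho_poly a b) x -> (niho_poly a b)^`().[x] != 0.
Proof.
move=> ab1 x; rewrite rootE niho_polyE => /eqP gx.
have -> : (niho_poly a b)^`().[x] = x ^+ 2 * (x ^+ 4 + b).
  rewrite /niho_poly derivD !derivB !deriv_mulC !derivXn derivC.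
  rewrite !(hornerE, hornerMn, hornerXn) /=.
  by apply: (eq_mod2 (z := 3 * x ^+ 6 - 2 * a * x ^+ 3 - 2 * b * x ^+ 2)); ring.
apply: contra_neq ab1 => /eqP; rewrite mulf_eq0 expf_eq0 /= => /orP[/eqP x0|/eqP x4].
  by move: gx => /eqP; rewrite x0 !expr0n /= !mulr0 !add0r oner_eq0.
transitivity (a * (x ^+ 4 + b) + x ^+ 3 * (x ^+ 4 + b)
  - (x ^+ 7 + a * x ^+ 4 + b * x ^+ 3 + 1) + 1); last by rewrite gx x4; ring.
by ring.
Qed.

(** * The count for q = 2 *)

(** On the circle x^3 = 1, so g(x) reduces to (1 + a)(x + (1 + a)). For a = 1 all three cube roots
    of unity are roots; otherwise only 1 + a = a^2 is, and it lies on the circle. *)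
Lemma count_circle_F4 (a w : K) (rs : seq K) :
    a ^+ 3 = 1 -> w ^+ 3 = 1 -> w != 1 -> uniq rs ->
    (forall x, (x \in rs) = root (niho_poly a (a ^+ 2)) x) ->
  count (circle 1) rs = (if a == 1%R then 3 else 1)%N.
Proof.
move=> a3 w3 w1 Urs rsE; rewrite -size_filter.
have cubeP (z : K) : z ^+ 3 = 1 -> z != 1 -> z ^+ 2 + z + 1 = 0.
  move=> z3 z1; apply: (@mulfI _ (z - 1)); first by rewrite subr_eq0.
  by rewrite mulr0; transitivity (z ^+ 3 - 1); [ring | rewrite z3 subrr].
have memE x : (x \in [seq y <- rs | circle 1 y])
    = (x ^+ 3 == 1) && ((1 + a) * (x + (1 + a)) == 0).
  rewrite mem_filter rsE rootE niho_polyE -[circle 1 x]/(x * x ^+ 2 == 1) -exprS.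
  apply: andb_id2l => /eqP x3.
  have x4 : x ^+ 4 = x by rewrite exprS x3 mulr1.
  have x7 : x ^+ 7 = x by rewrite (exprD x 3 4) x3 x4 mul1r.
  by congr (_ == 0); apply: (eq_mod2 (z := - a)); rewrite x7 x4 x3; ring.
have Uf : uniq [seq y <- rs | circle 1 y] by rewrite filter_uniq.
have [a1 | a1] := eqVneq a 1.
  suff /perm_size -> : perm_eq [seq y <- rs | circle 1 y] [:: 1; w; w ^+ 2] by [].
  have w0 : w != 0 by apply: contra_eq_neq w3 => ->; rewrite expr0n eq_sym oner_eq0.
  have ww1 := cubeP w w3 w1.
  apply: uniq_perm => // [|x].
    rewrite /= !inE negb_or !andbT eq_sym w1 /=; apply/andP; split.
      apply: contraNneq w1 => w2; apply/eqP.
      by rewrite -w3 exprSr -w2 mul1r.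
    by apply: contraNneq w1 => w2; apply/eqP/(mulfI w0); rewrite mulr1 -expr2 -w2.
  rewrite memE a1 (addrr_pchar2 charK) mul0r eqxx andbT !inE -subr_eq0.
  have -> : x ^+ 3 - 1 = (x - 1) * (x - w) * (x - w ^+ 2).
    transitivity (x ^+ 3 - w ^+ 3 - (w ^+ 2 + w + 1) * (x ^+ 2 - x * w)); last by ring.
    by rewrite ww1 w3 mul0r subr0.
  by rewrite !mulf_eq0 !subr_eq0 orbA.
suff /perm_size -> : perm_eq [seq y <- rs | circle 1 y] [:: 1 + a] by [].
apply: uniq_perm => // x; rewrite memE inE mulf_eq0.
have a10 : 1 + a != 0 by rewrite -(oppr_pchar2 charK a) subr_eq0 eq_sym.
rewrite (negPf a10) /= -[X in x + X](oppr_pchar2 charK) subr_eq0.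
apply: andb_idl => /eqP ->; have aa1 := cubeP a a3 a1.
have -> : 1 + a = a ^+ 2.
  apply/eqP; rewrite -subr_eq0 (oppr_pchar2 charK) -aa1; apply/eqP; ring.
by rewrite -exprM mulnC exprM a3 expr1n.
Qed.

End CharTwo.

(** * From sequences of roots to the counts [Z] *)

(** All roots being simple, removing duplicates loses no factor. *)
Lemma prod_distinct_roots (K : closedFieldType) (p : {poly K}) :
    p \is monic -> (forall x, root p x -> p^`().[x] != 0) ->
  \prod_(x <- distinct_roots p) ('X - x%:P) = p.
Proof.
move=> /monicP lead1 sep; rewrite /distinct_roots.
case: closed_field_poly_normal => r /= Dp.
have {}Dp : p = \prod_(x <- r) ('X - x%:P) by rewrite [LHS]Dp lead1 scale1r.
rewrite undup_id // -separable_prod_XsubC -Dp unlock.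
exact/Pdiv.ClosedField.coprimepP.
Qed.

Section EvenDegree.

Variables (F : finFieldType) (K : closedFieldType) (iota : {rmorphism F -> K}).
Variable n : nat.
Hypothesis cardF : #|F| = (4 ^ n)%N.

Lemma pchar2_F : 2%N \in [pchar F].
Proof.
by apply: (@card_finPcharP F 2 (2 * n)) => //; rewrite cardF expnM.
Qed.

Let charK : 2%N \in [pchar K].
Proof. exact: (rmorph_pchar iota pchar2_F). Qed.

Lemma sqrt_card_eq : sqrt_card F = (2 ^ n)%N.
Proof.
rewrite /sqrt_card cardF (_ : (4 ^ n)%N = Nat.mul (2 ^ n) (2 ^ n)) ?PeanoNat.Nat.sqrt_square //.
by rewrite multE mulnn -!expnM mulnC expnM.
Qed.

Lemma tauE (a : F) : tau F (iota a) = iota a ^+ (2 ^ n).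
Proof. by rewrite /tau sqrt_card_eq. Qed.

Lemma tauK (a : F) : tau F (iota a) ^+ (2 ^ n) = iota a.
Proof.
rewrite tauE -exprM mulnn -expnM mulnC expnM -[(2 ^ 2)%N]/4%N -cardF -rmorphXn.
by rewrite expf_card.
Qed.

Lemma Z_count (a : F) :
  Z iota a = count (circle n) (distinct_roots (niho_poly (iota a) (tau F (iota a)))).
Proof.
rewrite /Z size_filter; apply: eq_count => u.
by rewrite -[LHS]/(u * u ^+ sqrt_card F == 1) sqrt_card_eq.
Qed.

Lemma Z_nondegenerate (a : F) : iota a * tau F (iota a) != 1 ->
  Z iota a \in [:: 0; 1; 2; 3; 5]%N.
Proof.
move=> ab1; rewrite Z_count.
apply: (count_circle_nondegenerate charK _ (tauK a) (undup_uniq _)); first by rewrite tauE.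
apply: prod_distinct_roots; first exact: niho_monic.
exact: niho_deriv_neq0.
Qed.

Lemma Z_degenerate (a : F) : iota a * tau F (iota a) = 1 ->
  (Z iota a <= if odd n then 4 else 2)%N.
Proof.
move=> ab1; rewrite Z_count; apply: count_circle_degenerate ab1 _ => //.
  exact: undup_uniq.
by move=> x; rewrite mem_distinct_roots ?niho_neq0.
Qed.

(** Four roots could only come from a b = 1, where the bound is 2 for even n. *)
Lemma Zset_even : ~~ odd n -> {subset Zset iota <= [:: 0; 1; 2; 3; 5]%N}.
Proof.
move=> even_n _ /mapP[a _ ->].
have [/Z_degenerate|/Z_nondegenerate//] := eqVneq (iota a * tau F (iota a)) 1.
by rewrite (negPf even_n); case: (Z _ _) => [|[|[|]]].
Qed.

Lemma Zset_odd : odd n -> {subset Zset iota <= [:: 0; 1; 2; 3; 4; 5]%N}.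
Proof.
move=> odd_n _ /mapP[a _ ->].
have [/Z_degenerate|/Z_nondegenerate] := eqVneq (iota a * tau F (iota a)) 1.
  by rewrite odd_n; case: (Z _ _) => [|[|[|[|[|]]]]].
by rewrite !inE; case/or4P => [->|->|->|/orP[->|->]]; rewrite ?orbT.
Qed.

End EvenDegree.

(** * The field with four elements *)

Section F4.

Variables (F : finFieldType) (K : closedFieldType) (iota : {rmorphism F -> K}).
Hypothesis cardF : #|F| = 4%N.

Lemma degenerate_F4 : degenerate F (4 * (sqrt_card F - 1) + 1).
Proof.
exists 2%N; first exact: (@pchar2_F _ 1).
(* Here q = 2 and d = 5, which is 2^1 modulo 3. *)
by exists 1%N; rewrite (@sqrt_card_eq _ 1) // cardF.
Qed.

Lemma Zset_F4 : Zset iota =i [:: 1; 3]%N.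
Proof.
have charK : 2%N \in [pchar K] by exact: (rmorph_pchar iota (@pchar2_F F 1 cardF)).
have cube (a : F) : a != 0 -> a ^+ 3 = 1.
  by move=> a0; apply: (mulIf a0); rewrite mul1r -exprSr -cardF expf_card.
(* This w serves twice: as a nontrivial cube root of unity in the count, and as a parameter that
   attains the value 1. The value 3 is attained at a = 1. *)
have [w w0 w1] : exists2 w : F, w != 0 & w != 1.
  have : (0 < #|~: [set (0%R : F); 1%R]|)%N.
    by rewrite cardsCs setCK cardF cards2 eq_sym oner_eq0.
  by case/card_gt0P=> w; rewrite !inE negb_or => /andP[]; exists w.
have ZE (a : F) : a != 0 -> Z iota a = (if a == 1%R then 3 else 1)%N.
  move=> a0; rewrite (@Z_count _ _ _ 1) // (@tauE _ _ _ 1) //.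
  rewrite (@count_circle_F4 _ charK (iota a) (iota w)) ?fmorph_eq1 //.
  - by rewrite -rmorphXn cube ?rmorph1.
  - by rewrite -rmorphXn cube ?rmorph1.
  - exact: undup_uniq.
  by move=> x; rewrite mem_distinct_roots ?niho_neq0.
have memZ (a : F) : a != 0 -> Z iota a \in Zset iota.
  by move=> a0; apply/mapP; exists a; rewrite // mem_enum unitfE.
move=> k; apply/idP/idP.
  case/mapP=> a; rewrite mem_enum unitfE => a0 ->; rewrite ZE //.
  by case: ifP.
rewrite !inE => /orP[]/eqP->.
  by have := memZ w w0; rewrite ZE // (negPf w1).
by have := memZ 1 (oner_neq0 _); rewrite ZE ?oner_neq0 // eqxx.
Qed.

End F4.

(* [finvect_type L] is L itself, with its structure of finite field; K is its
   algebraic closure. *)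
Theorem theorem2p6 (F4 : finFieldType) (cardF4 : #|F4| = 4%N)
    (L : fieldExtType F4) (K : closedFieldType)
    (iota : {rmorphism finvect_type L -> K})
    (algK : forall x : K, algebraicOver iota x) :
  let F : finFieldType := finvect_type L in
  let d := (4 * (sqrt_card F - 1) + 1)%N in
  let n := \dim {:L} in
  [/\ ~~ odd n -> {subset Zset iota <= [:: 0; 1; 2; 3; 5]%N},
      odd n -> (1 < n)%N -> {subset Zset iota <= [:: 0; 1; 2; 3; 4; 5]%N}
    & n = 1%N -> degenerate F d /\ Zset iota =i [:: 1; 3]%N].
Proof.
move=> F d n.
have cardF : #|F| = (4 ^ n)%N.
  by rewrite -cardF4 -(@card_vspacef _ F (Vector.class L)) card_vspace.
split=> [even_n | odd_n _ | n1].
- exact: Zset_even cardF even_n.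
- exact: Zset_odd cardF odd_n.
by rewrite n1 in cardF; split; [exact: degenerate_F4 | exact: Zset_F4].
Qed.
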